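(* Let $\delta\in\mathbb{R}$ be far from the dyadic rationals, i.e. $d(\delta)>0$. Then for each $f\in L^1_{\mathrm{loc}}(\mathbb{R}^2)$, $M_s(f)$ is comparable pointwise with $$M_s^{d,d}(f)+M_s^{d,\delta}(f)+M_s^{\delta,d}(f)+M_s^{\delta,\delta}(f),$$ and the implicit constants are independent of $f$.
   Context: Dyadic grids: $\mathcal{D}=\bigcup_{n\in\mathbb{Z}}\mathcal{D}_n$, where $\mathcal{D}_n=\{[k2^{-n},(k+1)2^{-n}) : k\in\mathbb{Z}\}$. For $\delta\in\mathbb{R}$, $\mathcal{D}^\delta=\bigcup_{n\in\mathbb{Z}}\mathcal{D}^\delta_n$, where $\mathcal{D}^\delta_n=\{I+\delta: I\in\mathcal{D}_n\}$ for $n\ge 0$; $\mathcal{D}^\delta_n=\{I+\delta+\sum_{j=n/2+1}^{0}2^{-2j} : I\in\mathcal{D}_n\}$ for $n<0$ even; and for $n<0$ odd, $\mathcal{D}_n^\delta$ is determined by nestedness, i.e. it consists of the left and right halves of the intervals of $\mathcal{D}^\delta_{n-1}$. Far from the dyadic rationals: $d(\delta):=\inf\{2^n|\delta-k/2^n| : n\in\mathbb{Z},\ n\ge 0,\ k\in\mathbb{Z}\}>0$. Strong maximal functions: $M_s(f)(x,y)=\sup_{R\ni(x,y)}\frac1{|R|}\int_R|f(u,v)|\,du\,dv$, supremum over all bounded rectangles $R\subset\mathbb{R}^2$ with sides parallel to the axes (and positive area) containing $(x,y)$. $M_s^{d,d}$, $M_s^{d,\delta}$, $M_s^{\delta,d}$,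 $M_s^{\delta,\delta}$ are defined in the same way with the supremum restricted to rectangles $R\ni(x,y)$ in $\mathcal{D}\times\mathcal{D}$, $\mathcal{D}\times\mathcal{D}^\delta$, $\mathcal{D}^\delta\times\mathcal{D}$, $\mathcal{D}^\delta\times\mathcal{D}^\delta$ respectively. Comparable pointwise means each side is bounded at every point by a constant multiple of the other. *)

(* Defs.v *)
From HB Require Import structures.
From mathcomp Require Import all_boot all_order all_algebra.
From mathcomp Require Import all_classical all_reals all_analysis.

Set Implicit Arguments.
Unset Strict Implicit.
Unset Printing Implicit Defensive.

Import Order.TTheory GRing.Theory Num.Theory.
Import numFieldNormedType.Exports.

Local Open Scope classical_set_scope.
Local Open Scope ring_scope.

Definition dyadic_grid_at {R : realType} (n : int) : set (set R) :=
  [set `[k%:~R * 2 ^ (- n), (k + 1)%:~R * 2 ^ (- n)[%classic | k in [set: int]].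

Definition dyadic_grid {R : realType} : set (set R) :=
  \bigcup_(n in [set: int]) dyadic_grid_at n.

Definition translates {R : realType} (t : R) (G : set (set R)) : set (set R) :=
  [set [set x + t | x in I] | I in G].

Definition halves {R : realType} (G : set (set R)) : set (set R) :=
  [set J | exists a b : R, [/\ a < b, G `[a, b[%classic &
    J = `[a, (a + b) / 2[%classic \/ J = `[(a + b) / 2, b[%classic]].

(* The shifted grid at the even level n = - 2m <= 0; the sum is
   \sum_{j = n/2 + 1}^{0} 2^{-2j}, reindexed by i = - j. *)
Definition shifted_even_grid_at {R : realType} (delta : R) (m : nat) :
    set (set R) :=
  translates (delta + \sum_(i < m) 2 ^+ (2 * i)%N)
    (dyadic_grid_at (- (2 * m)%N%:Z)).

(* [Negz m] is the integer n = - m.+1, so n is even iff m is odd; when m is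
   even, the level n - 1 is - m.+2. *)
Definition shifted_grid_at {R : realType} (delta : R) (n : int) :
    set (set R) :=
  match n with
  | Posz _ => translates delta (dyadic_grid_at n)
  | Negz m => if odd m then shifted_even_grid_at delta (m.+1)./2
              else halves (shifted_even_grid_at delta (m.+2)./2)
  end.

Definition shifted_grid {R : realType} (delta : R) : set (set R) :=
  \bigcup_(n in [set: int]) shifted_grid_at delta n.

Definition dyadic_distance {R : realType} (delta : R) : R :=
  inf [set 2 ^+ n * `|delta - k%:~R / 2 ^+ n|
      | n in [set: nat] & k in [set: int]].

Definition bounded_intervals {R : realType} : set (set R) :=
  [set I : set R |
    [/\ is_interval I, bounded_set I & (0 < lebesgue_measure I)%E]].

Definition rectangles {R : realType} (G H : set (set R)) : set (set (R * R)) :=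
  [set I `*` J | I in G & J in H].

Definition lebesgue_measure2 {R : realType} :
    {measure set (measurableTypeR R * measurableTypeR R) -> \bar R} :=
  (lebesgue_measure \x lebesgue_measure)%E.

(* [measurable_fun] on the product type would mean Borel measurability;
   Lebesgue measurability refers to the completed sigma-algebra. The library's
   integral of a nonnegative function is the supremum over the Borel simple
   functions below it, hence agrees with the Lebesgue integral for all
   Lebesgue measurable functions. *)
Definition lebesgue_measurable_fun2 {R : realType} (f : R * R -> R) : Prop :=
  forall B : set (measurableTypeR R), measurable B ->
    measurable_realfun.completed_algebra_gen (@lebesgue_measure2 R)
      (f @^-1` B).

Definition locally_integrable2 {R : realType} (f : R * R -> R) : Prop :=
  lebesgue_measurable_fun2 f /\
  forall K : set (R * R), compact K ->
    (\int[@lebesgue_measure2 R]_(z in K) `|f z|%:E < +oo)%E.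

Definition average2 {R : realType} (f : R * R -> R) (Q : set (R * R)) :
    \bar R :=
  ((lebesgue_measure2 Q)^-1 * \int[@lebesgue_measure2 R]_(z in Q) `|f z|%:E)%E.

Definition rect_maximal {R : realType} (F : set (set (R * R))) (f : R * R -> R)
    (z : R * R) : \bar R :=
  ereal_sup [set average2 f Q | Q in [set Q | F Q /\ Q z]].

Definition strong_maximal {R : realType} : (R * R -> R) -> R * R -> \bar R :=
  rect_maximal (rectangles bounded_intervals bounded_intervals).

(* Main.v *)
(** In one variable, let D and D^delta be restricted to intervals of length
    l = 4^e, e an integer. Their endpoints are separated by at least c * l for
    some c = c(delta) > 0. A bounded interval I contained in no interval of
    either restricted grid has in its closure an endpoint of each, so
    |I| >= c * l; hence, taking l >= |I| / c minimal, I lies in an interval of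
    length at most 4 |I| / c of one of the two grids. Applying this to both
    sides of a rectangle bounds its average by (4 / c)^2 times an average over
    a rectangle of one of the four families. *)

Require Import Defs.
From HB Require Import structures.
From mathcomp Require Import all_boot all_order all_algebra.
From mathcomp Require Import all_classical all_reals all_analysis.
From mathcomp Require Import ring lra zify.
Import Order.TTheory GRing.Theory Num.Theory.
Import numFieldNormedType.Exports.
Local Open Scope ring_scope.

(* Unlike in the library's [ge0_subset_integral], [f] need not be measurable:
   here it is only measurable for the completed sigma-algebra. *)
Lemma ge0_le_integral_subset d (T : measurableType d) (R : realType)
    (mu : {measure set T -> \bar R}) (A B : set T) (f : T -> \bar R) :
  (forall x, 0 <= f x)%E -> (A `<=` B)%classic ->
  (\int[mu]_(x in A) f x <= \int[mu]_(x in B) f x)%E.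
Proof.
move=> f0 AB; rewrite !ge0_integralE//.
apply: ereal_sup_le => _ [h /= hf <-]; exists h => //= x.
apply: le_trans (hf x) _; rewrite /patch.
have [xA|xA] := boolP (x \in A); first by rewrite mem_set//; exact/AB/set_mem.
by case: ifP => // _; exact: f0.
Qed.

(** * Bounded intervals and their lengths *)

(** With [inf I] and [sup I] as endpoints, containment in the closed hull treats all four endpoint
    types at once. *)
Lemma bounded_interval_hull (R : realType) (I : set R) :
  bounded_intervals I -> exists a b : R, [/\ a < b,
    (I `<=` `[a, b]%classic)%classic & lebesgue_measure I = (b - a)%:E].
Proof.
move=> [/is_intervalP Iitv Ibnd mI].
have [M [_ IM0]] := Ibnd.
have IM x : I x -> `|x| <= M + 1.
  by move=> Ix; apply: (IM0 (M + 1)) => //; rewrite ltrDl.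
exists (inf I), (sup I).
have lbI : has_lbound I.
  by exists (- (M + 1)) => x /IM; rewrite ler_norml => /andP[].
have ubI : has_ubound I.
  by exists (M + 1) => x /IM; rewrite ler_norml => /andP[].
have eI : lebesgue_measure I =
    if inf I < sup I then (sup I - inf I)%:E else 0%E.
  rewrite {1}Iitv lebesgue_measure_itv /Rhull.
  by rewrite (asboolT lbI) (asboolT ubI)/= lte_fin EFinB.
move: mI; rewrite eI; case: ifPn => // [ab _|]; last by rewrite ltxx.
split=> // x Ix /=; rewrite in_itv/=; apply/andP; split.
  exact: ge_inf.
exact: ub_le_sup.
Qed.

Lemma half_open_bounded_interval (R : realType) (a b : R) :
  a < b -> bounded_intervals `[a, b[%classic.
Proof.
move=> ab; split.
- exact: interval_is_interval.
- exists (`|a| + `|b|); split; first exact: num_real.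
  move=> M ltM x /=; rewrite in_itv/= => /andP[ax xb].
  have := ler_norm b; have := ler_norm (- a); rewrite normrN ler_norml.
  by have := normr_ge0 a; have := normr_ge0 b; lra.
- by rewrite lebesgue_measure_itv/= lte_fin ab -EFinB lte_fin subr_gt0.
Qed.

(** * Scales 4^e, and covering by a grid and its translate *)

Lemma pow4_between1 (R : realType) (y : R) : 1 <= y ->
  exists m : nat, 4 ^+ m <= y < 4 ^+ m.+1.
Proof.
move=> y1.
have ex : exists m, y < 4 ^+ m.
  exists (Num.bound y); apply: lt_le_trans (upper_nthrootP (leqnn _)) _.
  by rewrite lerXn2r ?nnegrE//; lra.
case: (ex_minnP ex) => -[|m] ym mmin; first by move: ym; rewrite expr0; lra.
exists m; rewrite ym andbT leNgt; apply/negP => /mmin; lia.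
Qed.

(** Lengths 4^m and 4^-m are kept apart because the translation defining D^delta depends on the
    level only for lengths above 1. *)
Lemma pow4_between (R : realType) (x : R) : 0 < x ->
  exists m : nat, (x <= 4 ^+ m <= 4 * x) \/ (x <= (4 ^+ m)^-1 <= 4 * x).
Proof.
move=> x0; have [x1|/ltW x1] := leP 1 x.
  have [m /andP[mx xm]] := pow4_between1 R x x1; exists m.+1; left.
  by rewrite (ltW xm)/= exprS ler_pM2l.
have y1 : 1 <= x^-1 by rewrite -[1]invr1 lef_pV2 ?posrE.
have [m /andP[my ym]] := pow4_between1 R x^-1 y1; exists m; right.
have p : 0 < 4 ^+ m :> R by exact: exprn_gt0.
apply/andP; split.
  by rewrite -[x]invrK lef_pV2 ?posrE ?invr_gt0.
rewrite -ler_pdivrMl// -invfM -exprS -[leRHS]invrK lef_pV2 ?posrE ?invr_gt0 ?exprn_gt0//.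
exact: ltW.
Qed.

(** Take the interval of each grid that contains a. If both miss b, their right endpoints both lie
    in ]a, b], so they differ by less than b - a, against the separation. *)
Lemma cover_by_translated_grids (R : realType) (l s a b : R) : 0 < l -> a <= b ->
  (forall k : int, b - a <= `|s - k%:~R * l|) ->
  exists k : int,
    (`[a, b] `<=` `[k%:~R * l, (k + 1)%:~R * l[)%classic \/
    (`[a, b] `<=` `[k%:~R * l + s, (k + 1)%:~R * l + s[)%classic.
Proof.
move=> l0 ab far.
have floorP (x : R) : exists k : int, k%:~R * l <= x < (k + 1)%:~R * l.
  exists (Num.floor (x / l)); rewrite -ler_pdivlMr// -ltr_pdivrMr//.
  exact: floor_itv.
have [k /andP[ka ak]] := floorP a; have [j /andP[ja aj]] := floorP (a - s).
have [bk|kb] := ltP b ((k + 1)%:~R * l).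
  by exists k; left => x /=; rewrite !in_itv/=; lra.
have [bj|jb] := ltP (b - s) ((j + 1)%:~R * l).
  by exists j; right => x /=; rewrite !in_itv/=; lra.
have := far (k - j); rewrite intrB mulrBl.
by move: ka ak ja aj kb jb; rewrite !intrD !mulrDl ler_normr; lra.
Qed.

(** * Intervals of D and D^delta *)

Lemma image_translate_itv (R : realType) (t a b : R) :
  [set x + t | x in `[a, b[]%classic = `[a + t, b + t[%classic.
Proof.
apply/seteqP; split=> [_ [x /= xab <-]|x /= xab].
  by move: xab; rewrite !in_itv/=; lra.
by exists (x - t); rewrite ?subrK//=; move: xab; rewrite !in_itv/=; lra.
Qed.

Definition half_open_family {R : realType} (G : set (set R)) : Prop :=
  forall I, G I -> exists a b : R, a < b /\ I = `[a, b[%classic.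

Lemma half_open_dyadic_grid_at (R : realType) (n : int) :
  half_open_family (@dyadic_grid_at R n).
Proof.
move=> _ [k _ <-]; exists (k%:~R * 2 ^ (- n)), ((k + 1)%:~R * 2 ^ (- n)).
by split=> //; rewrite intrD mulrDl mul1r ltrDl exprz_gt0.
Qed.

Lemma half_open_translates (R : realType) (G : set (set R)) (t : R) :
  half_open_family G -> half_open_family (translates t G).
Proof.
move=> GE _ [I GI <-]; have [a [b [ab ->]]] := GE _ GI.
by exists (a + t), (b + t); rewrite ltrD2r image_translate_itv.
Qed.

Lemma half_open_halves (R : realType) (G : set (set R)) :
  half_open_family (halves G).
Proof.
move=> _ [a [b [ab _ [->|->]]]].
  by exists a, ((a + b) / 2); split=> //; lra.
by exists ((a + b) / 2), b; split=> //; lra.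
Qed.

Lemma half_open_dyadic_grid (R : realType) :
  half_open_family (@dyadic_grid R).
Proof. by move=> I [n _]; exact: half_open_dyadic_grid_at. Qed.

Lemma half_open_shifted_grid (R : realType) (delta : R) :
  half_open_family (shifted_grid delta).
Proof.
move=> I [[n|m] _] /=.
  exact/half_open_translates/half_open_dyadic_grid_at.
case: ifP => _; last exact: half_open_halves.
exact/half_open_translates/half_open_dyadic_grid_at.
Qed.

(** Only even levels, of lengths 4^m and 4^-m, enter the covering: there D^delta is an explicit
    translate of D. *)
Lemma dyadic_grid_pow4 (R : realType) (m : nat) (k : int) :
  @dyadic_grid R `[k%:~R * 4 ^+ m, (k + 1)%:~R * 4 ^+ m[%classic.
Proof.
exists (- (2 * m)%N%:Z) => //; exists k => //.
by rewrite opprK -exprnP exprM; have -> : 2 ^+ 2 = 4 :> R by ring.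
Qed.

Lemma dyadic_grid_pow4V (R : realType) (m : nat) (k : int) :
  @dyadic_grid R `[k%:~R * (4 ^+ m)^-1, (k + 1)%:~R * (4 ^+ m)^-1[%classic.
Proof.
exists ((2 * m)%N%:Z) => //; exists k => //.
by rewrite -invr_expz -exprnP exprM; have -> : 2 ^+ 2 = 4 :> R by ring.
Qed.

Lemma shifted_grid_pow4V (R : realType) (delta : R) (m : nat) (k : int) :
  shifted_grid delta
    `[k%:~R * (4 ^+ m)^-1 + delta, (k + 1)%:~R * (4 ^+ m)^-1 + delta[%classic.
Proof.
exists ((2 * m)%N%:Z) => //=; rewrite -image_translate_itv.
eexists; last reflexivity.
exists k => //.
by rewrite -invr_expz -exprnP exprM; have -> : 2 ^+ 2 = 4 :> R by ring.
Qed.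

Lemma shifted_grid_pow4 (R : realType) (delta : R) (m : nat) (k : int) :
  let s := delta + \sum_(i < m) 2 ^+ (2 * i)%N in
  shifted_grid delta
    `[k%:~R * 4 ^+ m + s, (k + 1)%:~R * 4 ^+ m + s[%classic.
Proof.
case: m => [|m] /=.
  by have := shifted_grid_pow4V _ delta 0 k; rewrite expr0 invr1 big_ord0 addr0.
(* This is the level -2(m + 1); its odd index selects the even-level branch of the definition. Level
   0, treated above, falls under [Posz] and has an empty sum. *)
exists (Negz (2 * m).+1) => //=.
have -> : odd (2 * m) = false by lia.
have -> /= : ((2 * m)./2.+1 = m.+1)%N by lia.
rewrite -image_translate_itv; eexists; last reflexivity.
exists k => //; rewrite opprK -exprnP exprM.
by have -> : 2 ^+ 2 = 4 :> R by ring.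
Qed.

(** * Separation of the endpoints of the two grids *)

Lemma dyadic_distance_le (R : realType) (delta : R) (n : nat) (k : int) :
  dyadic_distance delta * (2 ^+ n)^-1 <= `|delta - k%:~R / 2 ^+ n|.
Proof.
rewrite ler_pdivrMr ?exprn_gt0// mulrC; apply: ge_inf.
  (* [inf] is a lower bound once the set is bounded below, here by 0. *)
  by exists 0 => _ [i _ [j _ <-]]; rewrite mulr_ge0.
by exists n => //; exists k.
Qed.

Lemma sum_pow4 (R : realType) (m : nat) :
  \sum_(i < m) 2 ^+ (2 * i)%N = (4 ^+ m - 1) / 3 :> R.
Proof.
rewrite subrX1; under eq_bigr do rewrite exprM.
have -> : 2 ^+ 2 = 4 :> R by ring.
by field.
Qed.

(* The level -2m shift is [4^m / 3 + (delta - 1/3)]; as [1/3] is at distance at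
   least [1/3] from the integers, this is far from [4^m Z] for large [m], while
   for small [m] the shift differs from [delta] by an integer. *)
Lemma shifted_grid_separation (R : realType) (delta : R) (m : nat) (k : int) :
  0 < dyadic_distance delta ->
  dyadic_distance delta / (1 + 3 * (dyadic_distance delta + `|delta - 3^-1|)) * 4 ^+ m <=
    `|delta + \sum_(i < m) 2 ^+ (2 * i)%N - k%:~R * 4 ^+ m|.
Proof.
set d := dyadic_distance delta => d0; set A : R := `|delta - 3^-1|.
set x : R := `|_ - k%:~R * _|.
have A0 : 0 <= A by exact: normr_ge0.
have dx : d <= x.
  have := dyadic_distance_le R delta 0
    (k * 4 ^+ m - \sum_(i < m) 2 ^+ (2 * i)%N).
  rewrite expr0 invr1 !mulr1 intrB intrM rmorphXn/= rmorph_sum/=.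
  under eq_bigr do rewrite rmorphXn/=.
  by rewrite opprB addrA.
have lx : 4 ^+ m / 3 <= x + A.
  have e : 4 ^+ m * `|3^-1 - k%:~R| <= x + A.
    have -> : 4 ^+ m * `|3^-1 - k%:~R| = `|4 ^+ m * (3^-1 - k%:~R)| :> R.
      by rewrite normrM [`|4 ^+ m|]ger0_norm ?exprn_ge0.
    apply: le_trans (ler_normB _ _); rewrite sum_pow4 le_eqVlt; apply/orP; left.
    by apply/eqP; congr (`|_|); field.
  apply: le_trans e; rewrite ler_pM2l ?exprn_gt0//.
  have [k0|k1] := leP k 0.
    have : k%:~R <= 0 :> R by rewrite lerz0.
    by rewrite ler_normr; lra.
  have : 1 <= k%:~R :> R by rewrite -[1]/(1%:~R) ler_int -gtz0_ge1.
  by rewrite ler_normr; lra.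
have q0 : 0 < 1 + 3 * (d + A) by rewrite /d; lra.
rewrite mulrAC ler_pdivrMr//.
(* The two bounds combine to d 4^m / 3 <= d x + d A <= x (d + A), which dictates the constant. *)
have : d * (4 ^+ m / 3) <= d * (x + A) by rewrite ler_pM2l.
have : d * A <= x * A by rewrite ler_wpM2r.
have : 0 <= x by exact: normr_ge0.
by nra.
Qed.

(** * Covering an interval by a comparable one of D or D^delta *)

Lemma dyadic_cover (R : realType) (delta : R) : 0 < dyadic_distance delta ->
  exists2 C : R, 0 < C & forall I : set R, bounded_intervals I ->
    exists J : set R, [/\ dyadic_grid J \/ shifted_grid delta J,
      (I `<=` J)%classic &
      (lebesgue_measure J <= C%:E * lebesgue_measure I)%E].
Proof.
move=> d0; set d := dyadic_distance delta in d0.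
pose c := d / (1 + 3 * (d + `|delta - 3^-1|)).
have A0 : 0 <= `|delta - 3^-1| by exact: normr_ge0.
have q0 : 0 < 1 + 3 * (d + `|delta - 3^-1|) by lra.
have c0 : 0 < c by rewrite divr_gt0.
(* The summand 1 in the denominator of c gives this; at lengths 4^-m the separation constant is d,
   so c serves at every scale. *)
have cd : c <= d by rewrite ler_pdivrMr// ler_peMr//; lra.
exists (4 / c); first by rewrite divr_gt0.
move=> I /bounded_interval_hull[a [b [ab Iab muI]]].
have measJ (l u : R) (k : int) : 0 < l -> l <= 4 * ((b - a) / c) ->
    (lebesgue_measure (`[(k%:~R * l + u)%R, ((k + 1)%:~R * l + u)%R[%classic : set R)
      <= (4 / c)%:E * lebesgue_measure I)%E.
  move=> l0 lab; rewrite muI lebesgue_measure_itv/= lte_fin.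
  rewrite intrD mulrDl mul1r addrAC ltrDl l0 -EFinB -EFinM lee_fin.
  have -> : k%:~R * l + u + l - (k%:~R * l + u) = l by ring.
  by rewrite mulrAC -mulrA.
have cover (l s : R) : 0 < l -> l <= 4 * ((b - a) / c) ->
    (forall k, dyadic_grid `[k%:~R * l, (k + 1)%:~R * l[%classic) ->
    (forall k, shifted_grid delta `[k%:~R * l + s, (k + 1)%:~R * l + s[%classic) ->
    (forall k : int, b - a <= `|s - k%:~R * l|) ->
    exists J : set R, [/\ dyadic_grid J \/ shifted_grid delta J,
      (I `<=` J)%classic &
      (lebesgue_measure J <= (4 / c)%:E * lebesgue_measure I)%E].
  move=> l0 lab Dl Sl far.
  have [k [abk|abk]] := cover_by_translated_grids _ _ _ _ _ l0 (ltW ab) far.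
    exists `[k%:~R * l, (k + 1)%:~R * l[%classic; split.
    - by left.
    - exact: subset_trans abk.
    - by have := measJ l 0 k l0 lab; rewrite !addr0.
  exists `[k%:~R * l + s, (k + 1)%:~R * l + s[%classic; split.
  - by right.
  - exact: subset_trans abk.
  - exact: measJ.
(* The length l satisfies (b - a) / c <= l <= 4 (b - a) / c: the lower bound makes b - a at most the
   separation c l, the upper one controls the measure of J. *)
have [|m [/andP[ml mu]|/andP[ml mu]]] := pow4_between R ((b - a) / c).
- by rewrite divr_gt0// subr_gt0.
- apply: (cover (4 ^+ m) (delta + \sum_(i < m) 2 ^+ (2 * i)%N)) => //.
  + by move=> k; exact: dyadic_grid_pow4.
  + by move=> k; exact: shifted_grid_pow4.
  + move=> k; apply: le_trans (shifted_grid_separation _ _ m k d0).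
    by rewrite -/d -/c mulrC -ler_pdivrMr.
- apply: (cover (4 ^+ m)^-1 delta) => //.
  + by move=> k; exact: dyadic_grid_pow4V.
  + by move=> k; exact: shifted_grid_pow4V.
  + move=> k; have := dyadic_distance_le _ delta (2 * m) k.
    rewrite exprM; have -> : 2 ^+ 2 = 4 :> R by ring.
    apply: le_trans; rewrite -/d.
    move: ml; rewrite ler_pdivrMr// mulrC => /le_trans; apply.
    by rewrite ler_wpM2r// invr_ge0 exprn_ge0.
Qed.

(** * Averages over rectangles and maximal functions *)

Lemma half_open_family_bounded_intervals (R : realType) (G : set (set R)) :
  half_open_family G -> (G `<=` bounded_intervals)%classic.
Proof.
by move=> GE I /GE[a [b [ab ->]]]; exact: half_open_bounded_interval.
Qed.

Lemma lebesgue_measure2_rectangle (R : realType) (I J : set R) :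
  bounded_intervals I -> bounded_intervals J ->
  @lebesgue_measure2 R (I `*` J)%classic =
    (lebesgue_measure I * lebesgue_measure J)%E.
Proof.
move=> [Iitv _ _] [Jitv _ _].
by apply: product_measure1E; exact: measurable_realfun.is_interval_measurable.
Qed.

Lemma average2_ge0 (R : realType) (f : R * R -> R) (Q : set (R * R)) :
  (0 <= average2 f Q)%E.
Proof.
by apply: mule_ge0; [rewrite inve_ge0|apply: integral_ge0 => z _; rewrite lee_fin].
Qed.

(** Enlarging the rectangle increases the integral of |f| and multiplies the area by at most C^2,
    one factor C per side. *)
Lemma average2_rectangle_le (R : realType) (f : R * R -> R) (C : R)
    (I1 I2 J1 J2 : set R) : 0 < C ->
  bounded_intervals I1 -> bounded_intervals I2 ->
  bounded_intervals J1 -> bounded_intervals J2 ->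
  (I1 `<=` J1)%classic -> (I2 `<=` J2)%classic ->
  (lebesgue_measure J1 <= C%:E * lebesgue_measure I1)%E ->
  (lebesgue_measure J2 <= C%:E * lebesgue_measure I2)%E ->
  (average2 f (I1 `*` I2)%classic <= (C ^+ 2)%:E * average2 f (J1 `*` J2)%classic)%E.
Proof.
move=> C0 bI1 bI2 bJ1 bJ2 IJ1 IJ2.
rewrite /average2 !lebesgue_measure2_rectangle//.
have [a1 [b1 [ab1 _ ->]]] := bounded_interval_hull _ _ bI1.
have [a2 [b2 [ab2 _ ->]]] := bounded_interval_hull _ _ bI2.
have [a3 [b3 [ab3 _ ->]]] := bounded_interval_hull _ _ bJ1.
have [a4 [b4 [ab4 _ ->]]] := bounded_interval_hull _ _ bJ2.
move: ab1 ab2 ab3 ab4; rewrite -(subr_gt0 a1) -(subr_gt0 a2) -(subr_gt0 a3) -(subr_gt0 a4).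
move: (b1 - a1) (b2 - a2) (b3 - a3) (b4 - a4) => i1 i2 j1 j2 i10 i20 j10 j20.
rewrite -!EFinM !lee_fin => ij1 ij2.
rewrite !inver !mulf_eq0 !gt_eqF//= muleA -EFinM.
apply: lee_pmul.
- by rewrite lee_fin invr_ge0 mulr_ge0 ?ltW.
- by apply: integral_ge0 => z _; rewrite lee_fin.
- rewrite lee_fin ler_pdivlMr ?mulr_gt0// mulrC ler_pdivrMr ?mulr_gt0//.
  by apply: le_trans (ler_pM (ltW j10) (ltW j20) ij1 ij2) _; rewrite mulrACA.
- apply: ge0_le_integral_subset => [z|[x y] [/= /IJ1 ? /IJ2 ?]//].
  by rewrite lee_fin.
Qed.

Lemma le_rect_maximal (R : realType) (F H : set (set (R * R))) (f : R * R -> R)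
    (z : R * R) :
  (F `<=` H)%classic -> (rect_maximal F f z <= rect_maximal H f z)%E.
Proof.
by move=> FH; apply: ereal_sup_le => _ [Q [/FH HQ Qz] <-]; exists Q.
Qed.

Lemma rectanglesS (R : realType) (G G' H H' : set (set R)) :
  (G `<=` G')%classic -> (H `<=` H')%classic ->
  (rectangles G H `<=` rectangles G' H')%classic.
Proof. by move=> GG HH Q [I /GG GI [J /HH HJ <-]]; exists I => //; exists J. Qed.

(** The supremum of an empty family is -oo, so some rectangle of the family must contain z. *)
Lemma rect_maximal_ge0 (R : realType) (G H : set (set R)) (f : R * R -> R)
    (z : R * R) :
  (exists2 I, G I & I z.1) -> (exists2 J, H J & J z.2) ->
  (0 <= rect_maximal (rectangles G H) f z)%E.
Proof.
move=> [I GI Iz] [J HJ Jz]; apply: le_ereal_sup_tmp.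
exists (average2 f (I `*` J)%classic); last exact: average2_ge0.
by exists (I `*` J)%classic => //; split=> //; exists I => //; exists J.
Qed.

Lemma dyadic_grid_cover (R : realType) (x : R) : exists2 I, dyadic_grid I & I x.
Proof.
have := dyadic_grid_pow4 R 0 (Num.floor x); rewrite expr0 !mulr1 => D.
by eexists; first exact: D; rewrite /= in_itv/= floor_itv.
Qed.

Lemma shifted_grid_cover (R : realType) (delta x : R) :
  exists2 I, shifted_grid delta I & I x.
Proof.
have := shifted_grid_pow4V R delta 0 (Num.floor (x - delta)).
rewrite expr0 invr1 !mulr1 => D; eexists; first exact: D.
by rewrite /= in_itv/= -lerBrDr -ltrBlDr floor_itv.
Qed.

Theorem proposition6p4 (R : realType) (delta : R)
    (hdelta : 0 < dyadic_distance delta) :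
  exists C1 C2 : R, [/\ 0 < C1, 0 < C2 &
    forall f : R * R -> R, locally_integrable2 f -> forall z : R * R,
      let S := (rect_maximal (rectangles dyadic_grid dyadic_grid) f z
        + rect_maximal (rectangles dyadic_grid (shifted_grid delta)) f z
        + rect_maximal (rectangles (shifted_grid delta) dyadic_grid) f z
        + rect_maximal (rectangles (shifted_grid delta) (shifted_grid delta)) f z)%E
      in (strong_maximal f z <= C1%:E * S)%E /\
         (S <= C2%:E * strong_maximal f z)%E].
Proof.
have [C C0 cover] := dyadic_cover _ _ hdelta.
(* C^2 comes from enlarging both sides of a rectangle; 4 counts the grid maximal functions, each at
   most M_s. *)
exists (C ^+ 2), 4; split=> //; first exact: exprn_gt0.
move=> f _ z S.
have Dbnd := half_open_family_bounded_intervals _ _ (half_open_dyadic_grid R).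
have Sbnd := half_open_family_bounded_intervals _ _ (half_open_shifted_grid R delta).
have Dz := @dyadic_grid_cover R; have Sz := @shifted_grid_cover R delta.
split; last first.
  have M0 : (0 <= strong_maximal f z)%E.
    apply: le_trans (le_rect_maximal _ _ _ _ _ (rectanglesS _ _ _ _ _ Dbnd Dbnd)).
    exact: rect_maximal_ge0.
  have -> : 4 = 1 + 1 + 1 + 1 :> R by ring.
  rewrite !EFinD !ge0_muleDl// ?adde_ge0// !mul1e.
  by rewrite !leeD//; apply/le_rect_maximal/rectanglesS.
(* Each of the four terms is at most their sum, the others being nonnegative. *)
have le_S G H : (G = dyadic_grid \/ G = shifted_grid delta) ->
    (H = dyadic_grid \/ H = shifted_grid delta) ->
    (rect_maximal (rectangles G H) f z <= S)%E.
  have DD0 := rect_maximal_ge0 R _ _ f z (Dz z.1) (Dz z.2).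
  have DS0 := rect_maximal_ge0 R _ _ f z (Dz z.1) (Sz z.2).
  have SD0 := rect_maximal_ge0 R _ _ f z (Sz z.1) (Dz z.2).
  have SS0 := rect_maximal_ge0 R _ _ f z (Sz z.1) (Sz z.2).
  move=> [->|->] [->|->]; rewrite /S.
  - by rewrite -!addeA leeDl// !adde_ge0.
  - by rewrite -!addeA addeCA leeDl// !adde_ge0.
  - by rewrite addeAC leeDr// !adde_ge0.
  - by rewrite leeDr// !adde_ge0.
(* The two sides of a rectangle are covered independently; the pair of grids obtained selects the
   term of S. *)
apply: ge_ereal_sup => _ [_ [[I1 bI1 [I2 bI2 <-]] [/= I1z I2z]] <-].
have [J1 [gJ1 IJ1 lJ1]] := cover I1 bI1.
have [J2 [gJ2 IJ2 lJ2]] := cover I2 bI2.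
have bJ1 : bounded_intervals J1 by case: gJ1; [exact: Dbnd|exact: Sbnd].
have bJ2 : bounded_intervals J2 by case: gJ2; [exact: Dbnd|exact: Sbnd].
apply: le_trans (average2_rectangle_le _ f _ _ _ _ _ C0 bI1 bI2 bJ1 bJ2 IJ1 IJ2 lJ1 lJ2) _.
rewrite lee_pmul2l ?lte_fin ?exprn_gt0//.
have in_sup G H : G J1 -> H J2 ->
    (average2 f (J1 `*` J2)%classic <= rect_maximal (rectangles G H) f z)%E.
  move=> GJ HJ; apply: ereal_sup_ubound; exists (J1 `*` J2)%classic => //; split.
    by exists J1 => //; exists J2.
  by split; [exact: IJ1|exact: IJ2].
by case: gJ1 gJ2 => [g1|g1] [g2|g2]; apply: le_trans (in_sup _ _ g1 g2) _;
  apply: le_S; [left|left|left|right|right|left|right|right].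
Qed.
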